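(* Let $X$ be a regular space such that every compact subset of $X$ is a $G_\delta$ subset (for example, a metrizable space). Then Bob has a winning strategy in $\mathsf{G}_{\mathrm{bnd}}(\mathcal{O},\mathcal{O})$ over $X$ if, and only if, there are a compact set $K\subset X$ and a countable set $N\subset X$ such that $X=K\cup N$.
   Context: Here $\omega=\{0,1,2,\dots\}$ and $\mathcal{O}$ denotes the set of open covers of $X$. The game $\mathsf{G}_{\mathrm{bnd}}(\mathcal{O},\mathcal{O})$ is played between Alice and Bob, with innings $n\in\omega$; in each inning $n$ Alice first chooses $A_n\in\mathcal{O}$ and then Bob responds with a finite $B_n\subset A_n$, each player knowing all previous moves. Bob wins if $\bigcup_{n\in\omega}B_n\in\mathcal{O}$ and there is a $k\in\omega$ such that $|B_n|\le k$ for every $n\in\omega$; otherwise Alice wins. *)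

(* Defs.v *)
From mathcomp Require Import all_boot all_order.
From mathcomp Require Import boolp classical_sets functions cardinality.
From mathcomp Require Import topology borel_hierarchy.

Set Implicit Arguments.
Unset Strict Implicit.
Unset Printing Implicit Defensive.

Local Open Scope classical_set_scope.

Section Gbnd.
Context {X : topologicalType}.

Definition open_cover (A : set (set X)) : Prop :=
  (forall U, A U -> open U) /\ \bigcup_(U in A) U = setT.

(* The pair (A_i, B_i) of moves of inning i. *)
Definition inning : Type := (set (set X) * set (set X))%type.

(* [s h A] is Bob's answer to Alice's move [A] after the completed innings [h],
   listed in chronological order. Legality of the answers is not built in: it is
   part of [Gbnd_winning]. *)
Definition bob_strategy : Type := seq inning -> set (set X) -> set (set X).

Definition history (A B : nat -> set (set X)) (n : nat) : seq inning :=
  mkseq (fun i => (A i, B i)) n.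

Definition follows (s : bob_strategy) (A B : nat -> set (set X)) : Prop :=
  forall n, B n = s (history A B n) (A n).

Definition bob_legal (A B : nat -> set (set X)) : Prop :=
  forall n, finite_set (B n) /\ B n `<=` A n.

Definition Gbnd_bob_wins (B : nat -> set (set X)) : Prop :=
  open_cover (\bigcup_n B n) /\ exists k : nat, forall n, (B n #<= `I_k)%card.

Definition Gbnd_winning (s : bob_strategy) : Prop :=
  forall A B : nat -> set (set X),
    (forall n, open_cover (A n)) -> follows s A B ->
    bob_legal A B /\ Gbnd_bob_wins B.

End Gbnd.

Arguments bob_strategy X : clear implicits.

Definition bob_has_winning_strategy_Gbnd (X : topologicalType) : Prop :=
  exists s : bob_strategy X, Gbnd_winning s.

(* Main.v *)
Require Import Defs.
From mathcomp Require Import all_boot all_order finmap.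
From mathcomp Require Import boolp classical_sets functions cardinality.
From mathcomp Require Import topology borel_hierarchy.

(** If [X = K `|` N], Bob spends inning 0 on a finite subcover of [K] and then
    catches one point of [N] per inning; this bounds his answers, by a number
    that depends on Alice's first cover.

    Conversely, let [s] win for Bob. The candidate for [K] is the set of
    condensation points of [X], the points all of whose neighbourhoods are
    uncountable. Both that [K] is compact and that its complement is countable
    rest on Telgarsky's analysis of a position [p]: the set [core W p] of the
    points that lie in the closure of Bob's answer to every refinement of [W] is
    closed and, because [X] is regular, compact, hence a [G_delta]. As [X] is
    Lindelof (let Alice repeat one cover), countably many of Alice's moves
    already cut every point off the core that lies outside it. Following these
    moves from each position gives a countable tree of positions whose cores
    contain every point not yet covered: a point outside all of them could be
    dodged forever ([uncovered_sub_cores]).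

    From the empty position, this makes [X] sigma-compact. A compact set [C] is
    countable away from the condensation points, since their trace on [C] is a
    compact [G_delta], so that the rest of [C] is a countable union of compact
    sets covered by countable open sets. Hence only countably many points are
    not condensation points.

    If from some position on Bob always answered with at most [k] sets, the cores
    would have at most [k] points, and only countably many points would be
    uncovered at that position. Now suppose that an open cover [A] has no finite
    subfamily covering the condensation points. Let Alice play only covers [R]
    such that the closure of each member of [R] lies in a member of [A]: at each
    position the closure of what Bob has covered misses a condensation point, so
    uncountably many points are uncovered and Bob's answers are not bounded from
    there on. Alice can thus force, for every [k] in turn, an answer with more
    than [k] sets, which defeats [s] ([condensation_compact]). *)

Set Implicit Arguments.
Unset Strict Implicit.
Unset Printing Implicit Defensive.

Local Open Scope classical_set_scope.

(** * Compactness by subcovers, and closure refinements *)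

Section Topology.
Context {X : topologicalType}.
Implicit Types (K : set X) (A B W : set (set X)).

Definition finer W A : Prop :=
  open_cover A /\ forall U, A U -> exists2 V, W V & U `<=` V.

Lemma open_coverP A : open_cover A <->
  (forall U, A U -> open U) /\ forall x, exists2 U, A U & U x.
Proof.
split=> -[Aop Acov]; split=> //.
  by move=> x; have : [set: X] x by []; rewrite -Acov.
by rewrite -subTset => x _; exact: Acov.
Qed.

(** If no finite subfamily covers [K], the sets that finite subfamilies leave of
    [K] form the base of a proper filter; a cluster point of it in [K] would lie
    in no member of the cover. The argument allows [X] to be empty. *)
Lemma compact_finite_subcover K A : compact K -> (forall U, A U -> open U) ->
  K `<=` \bigcup_(U in A) U ->
  exists B, [/\ finite_set B, B `<=` A & K `<=` \bigcup_(U in B) U].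
Proof.
move=> cK Aop KA; apply: contrapT => nB.
pose F := filter_from [set B | finite_set B /\ B `<=` A]
  (fun B => K `\` \bigcup_(U in B) U).
have FF : ProperFilter F.
  apply: filter_from_proper; last first.
    move=> B [Bfin BA]; apply: contrapT => KB; apply: nB; exists B; split=> // x Kx.
    by apply: contrapT => Bx; apply: KB; exists x.
  apply: filter_from_filter; first by exists set0; split=> //; exact: finite_set0.
  move=> B1 B2 [fB1 B1A] [fB2 B2A]; exists (B1 `|` B2).
    by split; [rewrite /= finite_setU | rewrite subUset].
  by rewrite bigcup_setU setDUr.
have FK : F K.
  exists set0; first by split=> //; exact: finite_set0.
  by move=> x [].
have [x [Kx xF]] := cK F FF FK.
have [U AU Ux] := KA x Kx.
have [] := xF (K `\` U) U.
- exists [set U]; last by rewrite bigcup_set1.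
  by split; [exact: finite_set1 | rewrite sub1set inE].
- by apply: open_nbhs_nbhs; split; [exact: Aop|].
by move=> y [[_ nUy] Uy].
Qed.

(** Only covers of the whole space are tested, as these are what Alice plays;
    a closed [K] supplies its complement as an additional member. *)
Lemma closed_compact_of_subcover K : closed K ->
  (forall A, open_cover A ->
    exists B, [/\ finite_set B, B `<=` A & K `<=` \bigcup_(U in B) U]) ->
  compact K.
Proof.
move=> clK subcov F PF FK; apply: contrapT => noclus.
pose A := [set U : set X | open U /\ F (~` U)].
have /subcov[B [/finite_fsetP[Bs ->] BA KB]] : open_cover A.
  apply/open_coverP; split=> [U []//|x].
  have [Kx|nKx] := pselect (K x); last first.
    by exists (~` K) => //; split; [exact: closed_openC | rewrite setCK].
  have : ~ cluster F x by move=> xF; apply: noclus; exists x.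
  rewrite clusterE => /existsNP[G /not_implyP[FG nGx]].
  exists (~` closure G) => //; split; first exact/closed_openC/closed_closure.
  by rewrite setCK; apply: filterS FG; exact: subset_closure.
have FC : F (\bigcap_(U in [set` Bs]) ~` U).
  by apply: filter_bigI => U UB; have [] := BA U UB.
have [x [Kx xB]] := filter_ex (filterI FK FC).
by have [U BU Ux] := KB x Kx; exact: (xB U BU).
Qed.

Lemma closure_bigcup_finite (I : choiceType) (B : set I) (F : I -> set X) :
  finite_set B ->
  closure (\bigcup_(i in B) F i) `<=` \bigcup_(i in B) closure (F i).
Proof.
move=> Bfin; have cl : closed (\bigcup_(i in B) closure (F i)).
  by apply: closed_bigcup => // i _; exact: closed_closure.
rewrite [X in _ `<=` X]((closure_id _).1 cl); apply: closureS => x [i Bi Fx].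
by exists i => //; exact: subset_closure.
Qed.

(** The one consequence of regularity used below: Alice can control the closures
    of the sets that Bob picks while staying within the refinements of [W]. *)
Lemma closure_refinement W A : regular_space X -> open_cover W -> open_cover A ->
  exists2 R, finer W R & forall U, R U -> exists2 V, A V & closure U `<=` V.
Proof.
move=> regX /open_coverP[Wop Wcov] /open_coverP[Aop Acov].
exists [set U | [/\ open U, exists2 V, W V & U `<=` V
                 & exists2 V, A V & closure U `<=` V]]; last by move=> U [].
split; last by move=> U [].
apply/open_coverP; split=> [U []//|x].
have [V WV Vx] := Wcov x; have [V' AV' V'x] := Acov x.
have [|N xN NV'] := regX x V'.
  by apply: open_nbhs_nbhs; split; [exact: Aop|].
(* [N] itself need not be open. *)
exists (interior N `&` V); last first.
  by split=> //; exact: xN.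
split; first by apply: openI; [exact: open_interior | exact: Wop].
- by exists V => // y [].
- exists V' => //; apply: subset_trans NV'; apply: closureS => y [Ny _].
  exact: interior_subset Ny.
Qed.

End Topology.

(** * Positions and their limit plays *)

Section Positions.
Context {X : topologicalType} (s : bob_strategy X).
Implicit Types (A W B : set (set X)) (p q e : seq (set (set X))).
Implicit Types M : nat -> set (set X).

(** A position is the list of Alice's moves, latest first: Bob's answers are
    determined by [s], and an extension of [p] has the form [e ++ p]. *)
Fixpoint inning_history p : seq (inning (X := X)) :=
  if p is A :: q then
    rcons (inning_history q) (A, s (inning_history q) A)
  else [::].

Definition reply p A : set (set X) := s (inning_history p) A.

Fixpoint covered p : set X :=
  if p is A :: q then covered q `|` \bigcup_(U in reply q A) U else set0.

Lemma covered_cat e p : covered p `<=` covered (e ++ p).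
Proof. by elim: e => //= A e IHe x px; left; exact: IHe. Qed.

Definition prefixes M n := rev (mkseq M n).

Lemma prefixesS M n :
  prefixes M n.+1 = M n :: prefixes M n.
Proof. by rewrite /prefixes mkseqS rev_rcons. Qed.

Lemma size_prefixes M n : size (prefixes M n) = n.
Proof. by rewrite size_rev size_mkseq. Qed.

Lemma prefixes_suffix M n e p :
  prefixes M n = e ++ p -> p = prefixes M (size p).
Proof.
elim: n e => [|n IHn] [|B e]; rewrite ?prefixesS //=.
- by move=> <-.
- by move=> <-; rewrite /= size_prefixes prefixesS.
- by move=> [_]; exact: IHn.
Qed.

Lemma later_position (P : nat -> seq (set (set X))) m n :
  (forall n, exists2 e, e <> [::] & P n.+1 = e ++ P n) ->
  m <= n -> exists e, P n = e ++ P m.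
Proof.
move=> ext; elim: n => [|n IHn]; first by rewrite leqn0 => /eqP ->; exists [::].
rewrite leq_eqVlt => /predU1P[->|]; first by exists [::].
rewrite ltnS => /IHn[e Pn]; have [e' _ ->] := ext n.
by exists (e' ++ e); rewrite Pn catA.
Qed.

(** The [n]th position has at least [n] moves, so Alice's move in inning [n] of the
    limit play can be read off position [n.+1]. *)
Lemma limit_of_positions (P : nat -> seq (set (set X))) :
  (forall n, exists2 e, e <> [::] & P n.+1 = e ++ P n) ->
  exists M, forall n, P n = prefixes M (size (P n)) /\ n <= size (P n).
Proof.
move=> ext.
have szP n : n <= size (P n).
  elim: n => // n IHn; have [[//|B e] _ ->] := ext n.
  by rewrite size_cat /= addSn ltnS (leq_trans IHn)// leq_addl.
exists (fun i => nth set0 (rev (P i.+1)) i) => n; split=> //.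
apply: (can_inj revK); rewrite /prefixes revK.
apply: (@eq_from_nth _ set0); first by rewrite size_mkseq size_rev.
move=> i; rewrite size_rev => iP; rewrite nth_mkseq //.
have [le_n_i|/(later_position ext)[e ->]] := leqP n i.
  have [e ->] := later_position ext (leqW le_n_i).
  by rewrite rev_cat nth_cat size_rev iP.
by rewrite rev_cat nth_cat size_rev szP.
Qed.

Hypothesis win : Gbnd_winning s.

(** All uses of the hypothesis that [s] is winning pass through here. Blocks of
    several moves are allowed from one position to the next because a large
    answer can only be forced after an uncontrolled number of innings. *)
Lemma winning_limit (P : nat -> seq (set (set X))) :
  (forall n, exists2 e, e <> [::] & P n.+1 = e ++ P n) ->
  (forall n A, A \in P n -> open_cover A) ->
  [/\ forall x, exists n, covered (P n) x,
      forall n e A p, P n = e ++ A :: p ->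
        finite_set (reply p A) /\ reply p A `<=` A
    & exists k : nat, forall n e A p, P n = e ++ A :: p ->
        (reply p A #<= `I_k)%card].
Proof.
move=> ext Pcov; have [M PM] := limit_of_positions ext.
have MPn n : exists e, P n.+1 = e ++ prefixes M n.+1.
  have [-> ] := PM n.+1; rewrite size_prefixes => le.
  apply: (later_position (P := prefixes M) _ le) => m.
  by exists [:: M m] => //; rewrite prefixesS.
have Mcov n : open_cover (M n).
  apply: (Pcov n.+1); have [e ->] := MPn n.
  by rewrite prefixesS mem_cat inE eqxx orbT.
pose B n := reply (prefixes M n) (M n).
have histE n : history M B n = inning_history (prefixes M n).
  by elim: n => // n IHn; rewrite prefixesS /= /history mkseqS -IHn /B /reply -IHn.
have [|leg [[_ Bcov] [k Bk]]] := win (A := M) (B := B) Mcov.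
  by move=> n; rewrite histE.
have mov n e C p : P n = e ++ C :: p -> reply p C = B (size p) /\ C = M (size p).
  rewrite (PM n).1 => /prefixes_suffix; rewrite /= prefixesS => -[CA pA].
  by rewrite /B -pA -CA.
split.
- move=> x; have [U [n _ BnU] Ux] : (\bigcup_(U in \bigcup_n B n) U) x.
    by rewrite Bcov.
  exists n.+1; have [e ->] := MPn n; apply: covered_cat.
  by rewrite prefixesS /=; right; exists U.
- by move=> n e C p /mov[-> ->]; exact: leg.
- by exists k => n e C p /mov[-> _]; exact: Bk.
Qed.

(** * Cores of positions *)

Definition legal W p := forall A, A \in p -> finer W A.

Lemma legal_cons W A p : finer W A -> legal W p -> legal W (A :: p).
Proof. by move=> fA lp B; rewrite inE => /predU1P[->//|]; exact: lp. Qed.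

Lemma reply_legal W p A : legal W p -> open_cover A ->
  finite_set (reply p A) /\ reply p A `<=` A.
Proof.
move=> lp oA; have [] := @winning_limit (fun n => ncons n A p).
- by move=> n; exists [:: A].
- elim=> [|n IHn] B /=; first by move=> /lp[].
  by rewrite inE => /predU1P[->//|]; exact: IHn.
by move=> _ leg _; exact: (leg 1 [::]).
Qed.

(** If Alice repeats one cover forever, Bob's answers form a countable subcover. *)
Lemma winning_Lindelof A : open_cover A ->
  exists B, [/\ countable B, B `<=` A & \bigcup_(U in B) U = setT].
Proof.
move=> oA; have oA0 n : legal A (ncons n A [::]).
  by elim: n => // n; apply: legal_cons; split=> // U; exists U.
have [|n B /oA0[]//|cov _ _] := @winning_limit (fun n => ncons n A [::]).
  by move=> n; exists [:: A].
exists (\bigcup_n reply (ncons n A [::]) A); split.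
- apply: bigcup_countable => // n _; apply: finite_set_countable.
  by have [] := reply_legal (oA0 n) oA.
- by move=> U [n _]; have [_] := reply_legal (oA0 n) oA; exact.
rewrite -subTset => x _; have [n] := cov x; elim: n => //= n IHn [/IHn//|[U]].
by exists U => //; exists n.
Qed.

Definition core W p : set X :=
  [set x | forall A, finer W A -> closure (\bigcup_(U in reply p A) U) x].

Lemma core_closed W p : closed (core W p).
Proof.
rewrite (_ : core W p = \bigcap_(A in finer W) closure (\bigcup_(U in reply p A) U)).
  by apply: closed_bigI => A _; exact: closed_closure.
by [].
Qed.

(** To cover the core by finitely many members of [A], let Alice play a refinement
    whose closures lie in members of [A]: the core lies in the union of the
    closures of Bob's finite answer. *)
Lemma core_compact W p : regular_space X -> open_cover W -> legal W p ->
  compact (core W p).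
Proof.
move=> regX oW lp; apply: closed_compact_of_subcover (@core_closed W p) _ => A oA.
have [R fR RA] := closure_refinement regX oW oA.
have [Rfin Rsub] := reply_legal lp fR.1.
have /choice[v vP] : forall U, exists V, R U -> A V /\ closure U `<=` V.
  move=> U; have [/RA[V AV UV]|nRU] := pselect (R U); first by exists V.
  by exists set0.
exists (v @` reply p R); split; first exact: finite_image.
  by move=> _ [U /Rsub /vP[AV _] <-].
move=> x /(_ R fR)/(closure_bigcup_finite Rfin)[U rU Ux].
by exists (v U); [exists U | exact: (vP U (Rsub _ rU)).2].
Qed.

(** Given [k.+1] points of the core, Alice plays a refinement of [W] in which the
    closure of each member contains at most one of them; Bob's [k] sets then have
    too few closures for all these points. *)
Lemma core_finite W p k : regular_space X -> accessible_space X ->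
  open_cover W -> legal W p ->
  (forall A, finer W A -> (reply p A #<= `I_k)%card) ->
  finite_set (core W p).
Proof.
move=> regX T1 oW lp bound; apply: contrapT => /(infinite_set_fset k.+1)[S SC Sk].
pose A := [set V : set X | open V /\
  forall x y, x \in S -> y \in S -> V x -> V y -> x = y].
have oA : open_cover A.
  apply/open_coverP; split=> [V []//|x].
  exists (~` ([set` S] `\ x)); last by move=> [_]; exact.
  split.
    apply/closed_openC; apply: (accessible_finite_set_closed.1 T1).
    by apply: finite_setD; exact: finite_fset.
  have only z : z \in S -> (~` ([set` S] `\ x)) z -> z = x.
    by move=> zS nz; apply: contrapT => zx; apply: nz.
  by move=> y z yS zS /(only _ yS)-> /(only _ zS)->.
have [R fR RA] := closure_refinement regX oW oA.
have [Rfin Rsub] := reply_legal lp fR.1.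
have /choice[v vP] : forall x, exists U, x \in S -> reply p R U /\ closure U x.
  move=> x; have [xS|nxS] := boolP (x \in S); last by exists set0.
  have [U rU Ux] := closure_bigcup_finite Rfin (SC x xS R fR).
  by exists U.
have v_inj : {in [set` S] &, injective v}.
  move=> x y; rewrite !inE /= => xS yS vxy.
  have [rx vx] := vP x xS; have [_ vy] := vP y yS.
  have [V [_ V1] UV] := RA _ (Rsub _ rx).
  by apply: V1 => //; apply: UV => //; rewrite vxy.
have Sle : ([set` S] #<= `I_k)%card.
  have vS : v @` [set` S] `<=` reply p R.
    by move=> _ [x xS <-]; exact: (vP x xS).1.
  apply: card_le_trans (bound R fR); apply: card_le_trans (subset_card_le vS).
  by rewrite (card_le_eqr (inj_card_eq v_inj)).
have := geq_card_fset_set Sle; rewrite set_fsetK => /(leq_trans Sk).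
by rewrite ltnn.
Qed.

(** Together with an open set [O m] containing the core, the complements of the
    closures of Bob's answers cover [X]; a countable subcover handles the points
    outside [O m]. The core being a [G_delta], countably many [m] suffice. *)
Lemma core_countable_cut W p : legal W p -> Gdelta (core W p) ->
  exists D, [/\ countable D, D `<=` finer W & forall x, ~ core W p x ->
    exists2 A, D A & ~ closure (\bigcup_(U in reply p A) U) x].
Proof.
move=> lp [O Oop coreO]; pose cut A := ~` closure (\bigcup_(U in reply p A) U).
have coverO m : open_cover (O m |` (cut @` finer W)).
  apply/open_coverP; split=> [U [->//|[A _ <-]]|x].
    exact/closed_openC/closed_closure.
  have [Cx|/existsNP[A /not_implyP[fA nAx]]] := pselect (core W p x).
    by exists (O m); [left | rewrite coreO in Cx; exact: Cx].
  by exists (cut A) => //; right; exists A.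
have /choice[B BP] := fun m => winning_Lindelof (coverO m).
have /choice[w wP] : forall V, exists A,
    (cut @` finer W) V -> finer W A /\ cut A = V.
  move=> V; have [[A fA AV]|nV] := pselect ((cut @` finer W) V); first by exists A.
  by exists set0.
exists (finer W `&` w @` \bigcup_m B m); split; last 2 first.
- exact: subIsetl.
- move=> x; rewrite coreO => /existsNP[m /not_implyP[_ nOx]].
  have [_ BO Bcov] := BP m.
  have [V BV Vx] : (\bigcup_(U in B m) U) x by rewrite Bcov.
  have [VO|cV] := BO V BV; first by case: nOx; rewrite -VO.
  have [fA AV] := wP V cV.
  exists (w V); last by rewrite -AV in Vx.
  by split=> //; exists V => //; exists m.
- apply: (sub_countable (subset_card_le (@subIsetr _ _ _))).
  apply: (sub_countable (card_image_le _ _)).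
  by apply: bigcup_countable => // m _; have [] := BP m.
Qed.

(** Branch over the countable sets of moves of [core_countable_cut], from [p] on.
    A point outside the core of each node is missed by Bob's answer to some branch
    at that node; taking these branches gives a play that never covers it. *)
Lemma uncovered_sub_cores W p : legal W p ->
  (forall q, legal W q -> Gdelta (core W q)) ->
  exists T : set (seq (set (set X))), [/\ countable T,
    forall q, T q -> legal W q /\ exists e, q = e ++ p
    & ~` covered p `<=` \bigcup_(q in T) core W q].
Proof.
move=> lp Gd.
have /choice[D DP] : forall q, exists D, legal W q -> (exists e, q = e ++ p) ->
    [/\ countable D, D `<=` finer W & forall x, ~ core W q x ->
    exists2 A, D A & ~ closure (\bigcup_(U in reply q A) U) x].
  move=> q; have [[lq eq]|nq] := pselect (legal W q /\ exists e, q = e ++ p).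
    by have [D ?] := core_countable_cut lq (Gd q lq); exists D.
  by exists set0 => lq eq; case: nq.
pose level := fix level n : set (seq (set (set X))) :=
  if n is m.+1 then \bigcup_(q in level m) (cons^~ q @` D q) else [set p].
have levelP n q : level n q -> legal W q /\ exists e, q = e ++ p.
  elim: n q => [|n IHn] q /=; first by move=> ->; split=> //; exists [::].
  move=> [r /IHn[lr er] [A DA <-]]; have [_ /(_ _ DA) fA _] := DP r lr er.
  split; first exact: legal_cons.
  by have [e ->] := er; exists (A :: e).
exists (\bigcup_n level n); split.
- apply: bigcup_countable => // n _; elim: n => [|n IHn] /=; first exact: countable1.
  apply: bigcup_countable => // q /levelP[lq eq].
  by apply: (sub_countable (card_image_le _ _)); have [] := DP q lq eq.
- by move=> q [n _ /levelP].
move=> x npx; apply: contrapT => nTx.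
have /choice[a aP] : forall q, exists A, (\bigcup_n level n) q ->
    D q A /\ ~ (\bigcup_(U in reply q A) U) x.
  move=> q; have [[n _ nq]|nq] := pselect ((\bigcup_n level n) q); last by exists set0.
  have [lq eq] := levelP n q nq; have [_ _ Dq] := DP q lq eq.
  have [|A DA Ax] := Dq x; first by move=> qx; apply: nTx; exists q => //; exists n.
  by exists A => _; split=> // /subset_closure.
pose P := fix P n := if n is m.+1 then a (P m) :: P m else p.
have PT n : level n (P n).
  elim: n => //= n IHn; exists (P n) => //; exists (a (P n)) => //.
  by have [] := aP (P n) => //; exists n.
have [|n A|cov _ _] := @winning_limit P; first by move=> n; exists [:: a (P n)].
  by have [lP _] := levelP n _ (PT n) => /lP[].
have [n] := cov x; elim: n => //= n IHn [//|].
by have [] := aP (P n) => //; exists n.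
Qed.

End Positions.

(** * Condensation points *)

Section Characterization.
Context {X : topologicalType}.

(** Singletons are compact, hence intersections of open sets. *)
Lemma compact_Gdelta_accessible :
  (forall K : set X, compact K -> Gdelta K) -> accessible_space X.
Proof.
move=> GdX x y xy; have [O Oop xO] := GdX _ (@compact_set1 _ x).
have /existsNP[m /not_implyP[_ nOy]] : ~ (\bigcap_i O i) y.
  by rewrite -xO => yx; rewrite yx eqxx in xy.
exists (O m); split; [exact: Oop| |exact: mem_set].
by rewrite inE; have : [set x] x by []; rewrite xO; exact.
Qed.

Definition condensation : set X :=
  [set x | forall U, open U -> U x -> ~ countable U].

Lemma condensation_closed : closed condensation.
Proof.
rewrite -[condensation]setCK; apply: open_closedC.
rewrite (_ : ~` _ = \bigcup_(U in [set U : set X | open U /\ countable U]) U).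
  by apply: bigcup_open => U [].
apply/seteqP; split=> x; last first.
  by move=> [U [Uop Uc] Ux] /(_ U Uop Ux).
move=> /existsNP[U /not_implyP[Uop /not_implyP[Ux /contrapT Uc]]].
by exists U.
Qed.

(** The trace of the condensation points on [K] is compact, so it is an
    intersection of open sets [O m]; each [K `\` O m] is compact and covered by
    countable open sets, hence countable. *)
Lemma compact_countable_off_condensation (K : set X) :
  (forall C : set X, compact C -> Gdelta C) ->
  compact K -> countable (K `\` condensation).
Proof.
move=> GdX cK.
have [O Oop KO] := GdX _ (compact_closedI cK condensation_closed).
apply: (@sub_countable _ _ _ (\bigcup_m (K `\` O m))).
  apply: subset_card_le => x [Kx nDx].
  have /existsNP[m /not_implyP[_ nOx]] : ~ (\bigcap_i O i) x.
    by rewrite -KO => -[].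
  by exists m.
apply: bigcup_countable => // m _.
have cKm : compact (K `\` O m).
  by rewrite setDE; apply: compact_closedI => //; exact: open_closedC.
have [||B [Bfin BA KB]] :=
  compact_finite_subcover (A := [set U | open U /\ countable U]) cKm.
- by move=> U [].
- move=> x [Kx nOx].
  have : ~ condensation x.
    move=> Dx; apply: nOx; have : (K `&` condensation) x by [].
    by rewrite KO; exact.
  move=> /existsNP[U /not_implyP[Uop /not_implyP[Ux /contrapT Uc]]].
  by exists U.
apply: sub_countable (subset_card_le KB) _.
by apply: bigcup_countable => [|U /BA[]//]; exact: finite_set_countable.
Qed.

Lemma covered_finite_subcover (s : bob_strategy X) A W p :
  Gbnd_winning s -> (forall U, W U -> exists2 V, A V & closure U `<=` V) ->
  legal W p -> exists B, [/\ finite_set B, B `<=` A &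
    closure (covered s p) `<=` \bigcup_(V in B) V].
Proof.
move=> win WA; elim: p => [_|R p IHp lRp] /=.
  exists set0; split=> //; by rewrite closure0.
have lp : legal W p by move=> Q Qp; apply: lRp; rewrite inE Qp orbT.
have fR : finer W R by apply: lRp; rewrite mem_head.
have [B [Bfin BA pB]] := IHp lp.
have [Rfin Rsub] := reply_legal win lp fR.1.
have /choice[v vP] : forall U, exists V, R U -> A V /\ closure U `<=` V.
  move=> U; have [RU|nRU] := pselect (R U); last by exists set0.
  have [V /WA[V' AV' VV'] UV] := fR.2 U RU.
  by exists V' => _; split=> //; apply: subset_trans VV'; exact: closureS.
exists (B `|` v @` reply s p R); split.
- by rewrite finite_setU; split=> //; exact: finite_image.
- by move=> V [/BA//|[U /Rsub/vP[AV _] <-]].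
rewrite closureU bigcup_setU; apply: setUSS => //.
move=> x /(closure_bigcup_finite Rfin)[U rU Ux].
by exists (v U); [exists U | exact: (vP U (Rsub _ rU)).2].
Qed.

(** Were all later answers of size at most [k], the cores of the tree above [p]
    would be finite, and their countable union contains the uncovered points. *)
Lemma winning_unbounded_reply (s : bob_strategy X) W p (k : nat) :
  regular_space X -> (forall C : set X, compact C -> Gdelta C) ->
  Gbnd_winning s -> open_cover W -> legal W p -> ~ countable (~` covered s p) ->
  exists e A, [/\ legal W (e ++ p), finer W A
                & ~ (reply s (e ++ p) A #<= `I_k)%card].
Proof.
move=> regX GdX win oW lp; apply: contra_notP => bounded.
have [T [Tc TP pT]] := uncovered_sub_cores win lp
  (fun q lq => GdX _ (core_compact win regX oW lq)).
apply: (sub_countable (subset_card_le pT)); apply: bigcup_countable => // q Tq.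
have [lq [e qE]] := TP q Tq; apply: finite_set_countable.
apply: (core_finite (k := k) win regX (compact_Gdelta_accessible GdX) oW lq).
move=> A fA; apply: contrapT => nA; apply: bounded.
by exists e, A; rewrite -qE.
Qed.

Lemma winning_sigma_compact (s : bob_strategy X) :
  regular_space X -> (forall C : set X, compact C -> Gdelta C) ->
  Gbnd_winning s ->
  exists T : set (set X), [/\ countable T, T `<=` compact
    & \bigcup_(K in T) K = setT].
Proof.
move=> regX GdX win.
(* Every open cover refines the trivial one, so Alice is not restricted. *)
pose W := [set [set: X]].
have oW : open_cover W.
  by split=> [U ->|]; [exact: openT | rewrite bigcup_set1].
have l0 : legal W [::] by [].
have [T [Tc TP pT]] := uncovered_sub_cores win l0
  (fun q lq => GdX _ (core_compact win regX oW lq)).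
exists (core s W @` T); split; first exact: sub_countable (card_image_le _ _) Tc.
- by move=> _ [q /TP[lq _] <-]; exact: core_compact.
- rewrite -subTset => x _; have [[]|q Tq qx] := pT x.
  by exists (core s W q) => //; exists q.
Qed.

(** An open cover without finite subfamily covering the condensation points lets
    Alice keep uncountably many points uncovered, so that [winning_unbounded_reply]
    applies at every position; the bound [k] of the limit play is then exceeded at
    stage [k]. *)
Lemma condensation_compact (s : bob_strategy X) :
  regular_space X -> (forall C : set X, compact C -> Gdelta C) ->
  Gbnd_winning s -> compact condensation.
Proof.
move=> regX GdX win; apply: closed_compact_of_subcover condensation_closed _ => A oA.
apply: contrapT => nB.
have [W [oW _] WA] := closure_refinement regX oA oA.
have grow n p : exists q, legal W p ->
    [/\ legal W q, exists2 e, e <> [::] & q = e ++ p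
      & exists R r, q = R :: r /\ ~ (reply s r R #<= `I_n)%card].
  have [lp|nlp] := pselect (legal W p); last by exists [::].
  have [|e [R [le fR nR]]] := winning_unbounded_reply n regX GdX win oW lp.
    have [B [Bfin BA pB]] := covered_finite_subcover win WA lp.
    have [x [Dx npx]] : exists x, condensation x /\ ~ closure (covered s p) x.
      apply: contrapT => /forallNP Dp; apply: nB; exists B; split=> // x Dx.
      by apply: pB; apply: contrapT => npx; exact: (Dp x).
    have := Dx _ (closed_openC (@closed_closure _ (covered s p))) npx.
    apply: contra_not; apply: sub_countable; apply: subset_card_le.
    by apply: subsetC; exact: subset_closure.
  exists (R :: (e ++ p)) => _; split; first exact: legal_cons.
    by exists (R :: e).
  by exists R, (e ++ p).
have /choice[g gP] : forall np, exists q, legal W np.2 -> _ := fun np => grow np.1 np.2.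
pose P := fix P n := if n is m.+1 then g (m, P m) else [::].
have lP n : legal W (P n) by elim: n => //= n /(gP (n, P n))[].
have [n|n R|_ _ [k bound]] := @winning_limit _ _ win P.
- by have [] := gP (n, P n) (lP n).
- by move=> /(lP n)[].
have [_ _ [R [r [Pk nR]]]] := gP (k, P k) (lP k).
by apply: nR; exact: (bound k.+1 [::]).
Qed.

(** Inning [n.+1] is devoted to the point of [N] numbered [n], if there is one. *)
Lemma compact_countable_winning (K N : set X) : compact K -> countable N ->
  K `|` N = setT -> bob_has_winning_strategy_Gbnd X.
Proof.
move=> cK cN KN.
have /choice[c cP] : forall A : set (set X), exists B, open_cover A ->
    [/\ finite_set B, B `<=` A & K `<=` \bigcup_(U in B) U].
  move=> A; have [oA|nA] := pselect (open_cover A); last by exists set0.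
  have [|x _|B ?] := compact_finite_subcover (A := A) cK; [by case: oA| |by exists B].
  by rewrite oA.2.
have /choice[u uP] : forall xA : X * set (set X), exists U, open_cover xA.2 ->
    xA.2 U /\ U xA.1.
  move=> [x A] /=; have [/open_coverP[_ /(_ x)[U AU Ux]]|nA] := pselect (open_cover A).
    by exists U.
  by exists set0.
have /pcard_injP[f f_inj] := cN.
pose pt n := [set x | N x /\ f x = n].
have pt_sub n : (pt n #<= `I_1)%card.
  apply/pcard_leP; apply/injfunPex; exists (fun=> 0) => // x y.
  rewrite !inE => -[Nx fx] [Ny fy] _.
  by apply: f_inj; rewrite ?inE // fx fy.
(* Inning 0 belongs to [K], so the points of [N] are served one inning late. *)
pose s (h : seq (inning (X := X))) (A : set (set X)) : set (set X) :=
  if size h is n.+1 then (fun x => u (x, A)) @` pt n else c A.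
exists s => A B oA fol.
have szh n : size (history A B n) = n by rewrite size_mkseq.
have B0 : B 0 = c (A 0) by rewrite fol /s szh.
have BS n : B n.+1 = (fun x => u (x, A n.+1)) @` pt n by rewrite fol /s szh.
have BSle n : (B n.+1 #<= `I_1)%card.
  by rewrite BS; exact: card_le_trans (card_image_le _ _) (pt_sub n).
have [B0fin B0A KB0] := cP _ (oA 0).
have leg : bob_legal A B.
  move=> [|n]; first by rewrite B0.
  split; first exact: card_le_finite (BSle n) (finite_II 1).
  by rewrite BS => _ [x _ <-]; have [] := uP (x, A n.+1) (oA n.+1).
split=> //; split.
  apply/open_coverP; split=> [U [n _ BU]|x].
    by have [Aop _] := oA n; apply: Aop; exact: (leg n).2.
  have [Kx|Nx] : (K `|` N) x by rewrite KN.
    have [U cU Ux] := KB0 x Kx; exists U => //.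
    by exists 0 => //; rewrite B0.
  exists (u (x, A (f x).+1)); last by have [] := uP (x, A (f x).+1) (oA _).
  by exists (f x).+1 => //; rewrite BS; exists x.
have /finite_setP[m B0m] := B0fin.
exists m.+1 => -[|n].
  by rewrite B0 (card_le_eql B0m) card_le_II.
by apply: card_le_trans (BSle n) _; rewrite card_le_II.
Qed.

End Characterization.

Theorem corollary4p20 (X : topologicalType)
    (regX : regular_space X)
    (GdX : forall C : set X, compact C -> Gdelta C) :
  bob_has_winning_strategy_Gbnd X <->
  exists K N : set X, compact K /\ countable N /\ K `|` N = setT.
Proof.
split=> [[s win]|[K [N [cK [cN KN]]]]]; last exact: compact_countable_winning cK cN KN.
exists condensation, (~` condensation); split; last split.
- exact: condensation_compact win.
- have [T [Tc Tcpt TX]] := winning_sigma_compact regX GdX win.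
  apply: (@sub_countable _ _ _ (\bigcup_(K in T) (K `\` condensation))).
    by rewrite -setD_bigcupl TX setTD.
  by apply: bigcup_countable => // K /Tcpt; exact: compact_countable_off_condensation.
- exact: setUv.
Qed.
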